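(* Let $\mathbb X$ be an aperiodic flow space represented by a proper symbolic sequence $\mathcal S=(\mathcal A_i,s_i)_{i\in\mathbb Z^+}$. Then the flow on $\mathbb X$ is minimal if and only if $\mathcal S$ is primitive.
   Context: A flow space is a compact metrizable space of topological dimension one with a continuous $\mathbb R$-action without fixed points; minimal means every orbit is dense, aperiodic means no orbit is homeomorphic to a circle. An expansion of $\mathbb X$ about $x_\bullet$: oriented wedges of circles $X_i$, positive maps $f_i\colon X_{i+1}\to X_i$ (continuous surjections, wedge point to wedge point, orientation preserving on each circle, locally injective away from the wedge point), projections $p_i\colon\mathbb X\to X_i$ (continuous surjections, locally injective and orientation preserving along orbits) with $p_i(x_\bullet)$ the wedge point, $p_n=f_n\circ\cdots\circ f_{m-1}\circ p_m$ ($m>n$), and $x\mapsto(p_i(x))_i$ a homeomorphism onto $\varprojlim(X_i,f_i)$. A symbolic sequence $\mathcal S$ (finite alphabets $\mathcal A_i$, maps $s_i\colon\mathcal A_{i+1}\to\mathcal A_i^*$) represents $\mathbb X$ if for some expansion and labellings of the circles of $X_i$ by $\mathcal A_i$, $s_i(b)$ is the ordered word of circles of $X_i$ traversed by the image of circle $b$ under $f_i$ (traversed once positively from the wedge point). Composition of symbolic maps is by concatenation: $(s\circ t)(c)=s(b_1)\cdots s(b_k)$ if $t(c)=b_1\cdots b_k$. A map $s\colon\mathcal B\to\mathcal A^*$ is proper if there are $c,d\in\mathcal A$ with every $s(b)=c\,v_b\,d$ ($v_b$ possibly empty), and primitive if every $s(b)$ contains every letter of $\mathcal A$. $\mathcal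 S$ is proper (resp. primitive) if for each $n$ there is $m>n$ with $s_n\circ\cdots\circ s_{m-1}$ proper (resp. primitive). *)

(* Defs.v *)
From HB Require Import structures.
From mathcomp Require Import all_boot all_order all_algebra.
From mathcomp Require Import all_classical all_reals all_analysis.
Set Implicit Arguments. Unset Strict Implicit. Unset Printing Implicit Defensive.
Import Order.TTheory GRing.Theory Num.Theory.
Import numFieldNormedType.Exports.
Local Open Scope classical_set_scope.
Local Open Scope ring_scope.

(* s i : A (i+1) -> (A i)^*.  (Indices start at 0 instead of 1.)            *)

Fixpoint scomp (A : nat -> Type) (s : forall i, A i.+1 -> seq (A i)) (n k : nat)
  : A (k + n).+1 -> seq (A n) :=
  match k return A (k + n).+1 -> seq (A n) with
  | 0 => s n
  | k'.+1 => fun c => flatten (map (@scomp A s n k') (s (k' + n).+1 c))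
  end.
Arguments scomp {A} s n k.

Definition proper_map (A B : Type) (t : B -> seq A) : Prop :=
  exists c d : A, forall b : B, exists v : seq A, t b = c :: v ++ [:: d].

Definition primitive_map (A : eqType) (B : Type) (t : B -> seq A) : Prop :=
  forall (b : B) (a : A), a \in t b.

(* for each n there is m > n (here m = k + n + 1) with s_n o ... o s_(m-1) proper *)
Definition proper_seq (A : nat -> finType) (s : forall i, A i.+1 -> seq (A i)) :=
  forall n, exists k, proper_map (scomp s n k).

Definition primitive_seq (A : nat -> finType) (s : forall i, A i.+1 -> seq (A i)) :=
  forall n, exists k, primitive_map (scomp s n k).

Section Topo.
Variable R : realType.

Definition cover_dim_le (X : topologicalType) (n : nat) : Prop :=
  forall (I : finType) (U : I -> set X),
    (forall i, open (U i)) -> (forall x, exists i, U i x) ->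
    exists (J : finType) (V : J -> set X),
      [/\ (forall j, open (V j)),
          (forall x, exists j, V j x),
          (forall j, exists i, V j `<=` U i) &
          (forall x (K : {set J}), (forall j, j \in K -> V j x) -> (#|K| <= n.+1)%N)].

Definition topological_dim_one (X : topologicalType) : Prop :=
  cover_dim_le X 1%N /\ ~ cover_dim_le X 0%N.

Definition is_flow (X : topologicalType) (phi : R -> X -> X) : Prop :=
  [/\ continuous (fun tx : R * X => phi tx.1 tx.2),
      (forall x, phi 0 x = x) &
      (forall s t x, phi (s + t) x = phi s (phi t x))].

Definition orbit (X : topologicalType) (phi : R -> X -> X) (x : X) : set X :=
  range (fun t => phi t x).

(* A flow space: compact metrizable (X is a pseudometric space that is       *)
(* Hausdorff, i.e. metric), of topological dimension one, with a continuous *)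
(* R-action without fixed points. *)
Definition flow_space (X : pseudoMetricType R) (phi : R -> X -> X) : Prop :=
  [/\ hausdorff_space X, compact [set: X], topological_dim_one X,
      is_flow phi & (forall x, exists t, phi t x <> x)].

Definition minimal_flow (X : topologicalType) (phi : R -> X -> X) : Prop :=
  forall x, dense (orbit phi x).

Definition homeomorphic_sets (X Y : topologicalType) (A : set X) (B : set Y) : Prop :=
  exists (f : X -> Y) (g : Y -> X),
    [/\ (forall a, A a -> B (f a)), (forall b, B b -> A (g b)),
        (forall a, A a -> g (f a) = a), (forall b, B b -> f (g b) = b) &
        ({within A, continuous f} /\ {within B, continuous g})].

Definition unit_circle : set (R * R) := [set p | p.1 ^+ 2 + p.2 ^+ 2 = 1].

Definition aperiodic_flow (X : topologicalType) (phi : R -> X -> X) : Prop :=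
  forall x, ~ homeomorphic_sets (orbit phi x) unit_circle.

(* Y is an oriented wedge of circles labelled by A, with wedge point w, via *)
(* q : A -> R -> Y, where q a restricted to [0,1] traverses the circle a    *)
(* positively from the wedge point: Y is Hausdorff, each q a is continuous  *)
(* on [0,1], the q a jointly cover Y, and q identifies exactly all the      *)
(* endpoints (a,0),(a,1) to the wedge point w (so Y is the quotient of      *)
(* A x [0,1] by that identification).                                        *)
Definition oriented_wedge (A : Type) (Y : topologicalType) (w : Y) (q : A -> R -> Y)
  : Prop :=
  [/\ hausdorff_space Y,
      (forall a, {within `[0, 1], continuous (q a)}),
      (forall a, q a 0 = w),
      (forall y, exists a t, t \in `[0, 1] /\ q a t = y) &
      (forall a a' t t', t \in `[0, 1] -> t' \in `[0, 1] ->
         (q a t = q a' t' <->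
          ((a = a' /\ t = t') \/ ((t == 0) || (t == 1)) /\ ((t' == 0) || (t' == 1)))))].

Definition strictly_incr_on (I : set R) (h : R -> R) : Prop :=
  forall u v, I u -> I v -> u < v -> h u < h v.

(* The path gamma restricted to [0,1] is the concatenation of the positive   *)
(* traversals (once, from the wedge point) of the circles u_0, ..., u_(k-1). *)
Definition traverses_word (A : Type) (Y : topologicalType) (q : A -> R -> Y)
  (gamma : R -> Y) (u : seq A) : Prop :=
  exists ts : seq R,
    [/\ size ts = (size u).+1, nth 0 ts 0 = 0, nth 0 ts (size u) = 1 &
        forall j a, onth u j = Some a ->
          nth 0 ts j < nth 0 ts j.+1 /\
          exists h : R -> R,
            [/\ {within `[nth 0 ts j, nth 0 ts j.+1], continuous h},
                h (nth 0 ts j) = 0, h (nth 0 ts j.+1) = 1,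
                strictly_incr_on `[nth 0 ts j, nth 0 ts j.+1] h &
                forall t, t \in `[nth 0 ts j, nth 0 ts j.+1] -> gamma t = q a (h t)]].

(* gamma : R -> Y is locally injective and orientation preserving: near      *)
(* every time t0 it runs positively (strictly increasing parameter) through *)
(* a circle on the left of t0 and through a circle on the right of t0.      *)
Definition positive_path (A : Type) (Y : topologicalType) (q : A -> R -> Y)
  (gamma : R -> Y) : Prop :=
  forall t0 : R, exists (e : R) (a a' : A) (h h' : R -> R),
    [/\ 0 < e,
        strictly_incr_on `[t0 - e, t0] h,
        strictly_incr_on `[t0, t0 + e] h',
        (forall t, t \in `[t0 - e, t0] -> h t \in `[0, 1] /\ gamma t = q a (h t)) &
        (forall t, t \in `[t0, t0 + e] -> h' t \in `[0, 1] /\ gamma t = q a' (h' t))].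

(* The symbolic sequence (A, s) represents the flow space (X, phi): there is *)
(* an expansion (X_i, f_i, p_i) of X about some point x0, together with     *)
(* labellings q_i of the circles of X_i by A_i, such that s_i(b) is the word *)
(* of circles traversed by f_i(circle b).                                   *)
Definition represents (A : nat -> finType) (s : forall i, A i.+1 -> seq (A i))
  (X : topologicalType) (phi : R -> X -> X) : Prop :=
  exists (Xw : nat -> topologicalType) (w : forall i, Xw i)
         (q : forall i, A i -> R -> Xw i)
         (f : forall i, Xw i.+1 -> Xw i) (p : forall i, X -> Xw i) (x0 : X),
  [/\
      (forall i, oriented_wedge (w i) (q i)),
      (forall i, [/\ continuous (f i), (forall y, exists z, f i z = y),
                     f i (w i.+1) = w i &
                     forall b, traverses_word (q i) (fun t => f i (q i.+1 b t)) (s i b)]),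
      (forall i, [/\ continuous (p i), (forall y, exists x, p i x = y),
                     p i x0 = w i,
                     (forall x, p i x = f i (p i.+1 x)) &
                     forall x, positive_path (q i) (fun t => p i (phi t x))]),
      (* x |-> (p_i x)_i is a homeomorphism onto the inverse limit *)
      (forall x y, (forall i, p i x = p i y) -> x = y) &
      [/\ (forall z : forall i, Xw i, (forall i, f i (z i.+1) = z i) ->
          exists x, forall i, p i x = z i) &
      (forall (U : set X) x, open U -> U x ->
          exists i (V : set (Xw i)), [/\ open V, V (p i x) & p i @^-1` V `<=` U])]].

End Topo.

(* Main.v *)
(* Let P_m be the set of points of X lying over the wedge point of X_m; the P_m
decrease to the base point x0.

If the sequence is primitive, let Z be an orbit closure. Its image in X_m is
closed and, following positive paths, cannot end inside a circle, so it contains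
a whole circle. When the words in X_n of the circles of X_m contain every
letter, the image of Z in X_n is everything, and Z = X.

If the flow is minimal, an orbit through the circle b of X_m stays in that
circle between two visits to P_m. The time r between these visits is bounded
below, since a positive path from the wedge point of X_n to itself runs around a
circle, and above, since otherwise the orbit would meanwhile enter the part of X
over a given circle a of X_n. For m large the visits are close to x0, so either
no such return time r is possible, or r is close to a period of x0; in the
latter case the segment is close to the whole orbit of x0, which is dense, so it
enters the part over a. Hence a is a letter of the word of b. *)
Require Import Defs.
From HB Require Import structures.
From mathcomp Require Import all_boot all_order all_algebra.
From mathcomp Require Import all_classical all_reals all_analysis.
From mathcomp Require Import zify lra.
Set Implicit Arguments. Unset Strict Implicit. Unset Printing Implicit Defensive.
Import Order.TTheory GRing.Theory Num.Theory.
Import numFieldNormedType.Exports.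
Local Open Scope classical_set_scope.
Local Open Scope ring_scope.

(** * Closed sets of times and paths on the real line *)

Section RealLine.
Variable R : realType.

Lemma closed_has_max (S : set R) : closed S -> S !=set0 -> has_ubound S ->
  exists2 m, S m & ubound S m.
Proof.
move=> cS S0 bS; exists (sup S); last by move=> x Sx; exact: ub_le_sup.
by have := closure_sup S0 bS; rewrite -((closure_id S).1 cS).
Qed.

Lemma closed_has_min (S : set R) : closed S -> S !=set0 -> has_lbound S ->
  exists2 m, S m & lbound S m.
Proof.
move=> cS [x Sx] [b bS].
have [||| m Sm mub] := @closed_has_max (-%R @^-1` S).
- by apply: closed_comp => // t _; exact: opp_continuous.
- by exists (- x); rewrite /preimage /= opprK.
- by exists (- b) => t /bS; rewrite lerNr.
by exists (- m) => // y Sy; rewrite lerNl; apply: mub; rewrite /preimage /= opprK.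
Qed.

Variables (Y : topologicalType) (gamma : R -> Y).
Hypothesis gamma_cont : continuous gamma.

(** [s1] is the last visit to [B] before [t0] and [s2] the first one after; both exist because the
    visiting times form a closed set. *)
Lemma excursion (B : set Y) (t1 t0 t2 : R) : closed B ->
  t1 <= t0 <= t2 -> B (gamma t1) -> B (gamma t2) -> ~ B (gamma t0) ->
  exists s1 s2, [/\ t1 <= s1 < t0, t0 < s2 <= t2, B (gamma s1), B (gamma s2) &
    forall t, s1 < t < s2 -> ~ B (gamma t)].
Proof.
move=> cB /andP[t10 t02] B1 B2 nB0.
have cpre : closed (gamma @^-1` B) by apply: closed_comp => // t _; exact: gamma_cont.
have [|||s1 [/= Bs1 s10] s1max] := @closed_has_max ([set t | t <= t0] `&` gamma @^-1` B).
- by apply: closedI => //; exact: closed_le.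
- by exists t1.
- by exists t0 => t [].
have [|||s2 [/= s20 Bs2] s2min] := @closed_has_min ([set t | t0 <= t] `&` gamma @^-1` B).
- by apply: closedI => //; exact: closed_ge.
- by exists t2.
- by exists t0 => t [].
exists s1, s2; split => //.
- rewrite s1max//= lt_neqAle Bs1 andbT; apply/eqP => s1t0.
  by apply: nB0; rewrite -s1t0.
- rewrite s2min//= andbT lt_neqAle s20 andbT; apply/eqP => s2t0.
  by apply: nB0; rewrite s2t0.
move=> t /andP[s1t ts2] Bt; have [tt0|t0t] := leP t t0.
  by have := s1max t (conj tt0 Bt); rewrite leNgt s1t.
by have := s2min t (conj (ltW t0t) Bt); rewrite leNgt ts2.
Qed.

(** The times spent in [O1] are both open and closed in the interval, which is connected. *)
Lemma open_disjoint_stay (O1 O2 : set Y) (i : interval R) (t0 : R) :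
  open O1 -> open O2 -> O1 `&` O2 = set0 ->
  (forall t, t \in i -> O1 (gamma t) \/ O2 (gamma t)) ->
  t0 \in i -> O1 (gamma t0) -> forall t, t \in i -> O1 (gamma t).
Proof.
move=> o1 o2 o12 cov t0i Ot0 t ti.
have /connected_intervalP con : is_interval [set` i] by exact: interval_is_interval.
suff : [set` i] `&` gamma @^-1` O1 = [set` i].
  by move=> /seteqP[_ /(_ t)] /=; move=> /(_ ti) [].
apply: con.
- by exists t0.
- by exists (gamma @^-1` O1) => //; apply: open_comp => // x _; exact: gamma_cont.
- exists (~` (gamma @^-1` O2)).
    by apply: open_closedC; apply: open_comp => // x _; exact: gamma_cont.
  apply/seteqP; split => x /= [xs Ox]; split => //.
    by move=> Ox2; have : (O1 `&` O2) (gamma x) by []; rewrite o12.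
  by case: (cov _ xs).
Qed.

End RealLine.

(** * Topology of a wedge of circles and positive paths in it *)

Section Wedge.
Variables (R : realType) (A : finType) (Y : topologicalType) (w : Y) (q : A -> R -> Y).
Hypothesis wedge : oriented_wedge w q.

Lemma arc_closed a (c d : R) : 0 <= c -> d <= 1 -> closed (q a @` `[c, d]).
Proof.
move: wedge => [hY cq _ _ _] c0 d1; apply: compact_closed => //.
apply: continuous_compact; last exact: segment_compact.
by apply: continuous_subspaceW (cq a); apply: subset_itv; rewrite bnd_simp.
Qed.

Lemma arc_preimage_closed a (c d : R) (C : set Y) : 0 <= c -> d <= 1 -> closed C ->
  closed (`[c, d] `&` q a @^-1` C).
Proof.
move: wedge => [_ cq _ _ _] c0 d1 cC.
(* [q a] is continuous only on [[0, 1]]; the preimage is traded for a closed set [V] of the line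
   that agrees with it there. *)
have /continuous_closedP/(_ _ cC)/closed_subspaceP[V cV VE] := cq a.
suff -> : `[c, d] `&` q a @^-1` C = `[c, d] `&` V.
  by apply: closedI => //; exact: itv_closed.
have sub x : `[c, d]%classic x -> `[0, 1]%classic x.
  by apply: subset_itv; rewrite bnd_simp.
apply/seteqP; split => x [/= xcd Cx]; split => //.
  by have [] : (V `&` `[0, 1]) x by rewrite VE; split => //; exact: sub.
by have [] : (q a @^-1` C `&` `[0, 1]) x by rewrite -VE; split => //; exact: sub.
Qed.

Lemma wedge_inj a b (u v : R) : 0 < u < 1 -> 0 <= v <= 1 -> q a u = q b v ->
  a = b /\ u = v.
Proof.
move: wedge => [_ _ _ _ qq] /andP[u0 u1] v01 quv.
have u01 : u \in `[0, 1] by rewrite in_itv /= !ltW.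
have [|[] //|[/orP[]/eqP uE _]] := (qq a b u v u01 _).1 quv; first by rewrite in_itv.
- by move: u0; rewrite uE ltxx.
- by move: u1; rewrite uE ltxx.
Qed.

Lemma wedge_end a (u : R) : 0 <= u <= 1 -> q a u = w <-> u = 0 \/ u = 1.
Proof.
move: wedge => [_ _ q0 _ qq] u01; rewrite -(q0 a) qq ?in_itv //= ?lexx ?ler01//.
split=> [[[_ ->]|[/orP[/eqP|/eqP] -> _]]|[->|->]]; [by left|by left|by right|by left|].
by right; rewrite !eqxx orbT.
Qed.

Lemma wedge_cover y : exists a u, 0 <= u <= 1 /\ y = q a u.
Proof.
move: wedge => [_ _ _ qs _]; have [a [u [u01 <-]]] := qs y.
by exists a, u; rewrite in_itv in u01.
Qed.

Lemma bigcup_arc_closed (I : set A) (c d : R) : 0 <= c -> d <= 1 ->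
  closed (\bigcup_(a in I) (q a @` `[c, d])).
Proof. by move=> *; apply: closed_bigcup => [|i _]; [exact: finite_finset|]; exact: arc_closed. Qed.

Lemma midpoints_closed : closed [set q a (2^-1) | a in [set: A]].
Proof.
rewrite -bigcup_imset1; apply: closed_bigcup => [|a _]; first exact: finite_finset.
have -> : [set q a 2^-1] = q a @` `[2^-1, 2^-1].
  by rewrite set_itv1 image_set1.
by apply: arc_closed; lra.
Qed.

Lemma wedge_point_closed : closed [set w].
Proof. by move: wedge => [hY _ _ _ _]; exact/accessible_closed_set1/hausdorff_accessible. Qed.

Lemma open_arc b : open (q b @` `]0, 1[).
Proof.
suff -> : q b @` `]0, 1[ =
    ~` ([set w] `|` \bigcup_(a in [set a | a != b]) (q a @` `[0, 1])).
  apply: closed_openC; apply: closedU; first exact: wedge_point_closed.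
  exact: bigcup_arc_closed.
apply/seteqP; split => [_ [u /= + <-]|y].
  rewrite in_itv /= => u01 [/= uw|[a /= ab [v /=]]].
    by have [|u0|u0] := (wedge_end b _).1 uw; lra.
  rewrite in_itv /= => v01 qvu.
  by have [ba _] := wedge_inj u01 v01 (esym qvu); rewrite ba eqxx in ab.
have [a [u [u01 ->]]] := wedge_cover y; move=> /not_orP[/= uw nab].
have ab : a = b.
  by apply/eqP; apply/negPn/negP => ab; apply: nab; exists a => //; exists u.
have uN0 : u != 0 by apply/eqP => u0; apply: uw; apply/wedge_end; [|left].
have uN1 : u != 1 by apply/eqP => u0; apply: uw; apply/wedge_end; [|right].
by rewrite ab; exists u => //=; rewrite in_itv /= !lt_neqAle eq_sym uN0 uN1.
Qed.

(** A positive path leaves the wedge point into the first halves and comes back from the second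
    halves; only midpoints and the wedge point separate the two. *)
Definition first_halves := \bigcup_(a in [set: A]) (q a @` `]0, 2^-1[).
Definition second_halves := \bigcup_(a in [set: A]) (q a @` `]2^-1, 1[).

Lemma halves_disjoint : first_halves `&` second_halves = set0.
Proof.
rewrite -subset0 => _ [[a _ [u /= + <-]] [b _ [v /=]]]; rewrite !in_itv /=.
by move=> u01 v01 quv; have [|| _] := wedge_inj _ _ quv; lra.
Qed.

Lemma halves_cover y : y <> w -> (forall a, y <> q a 2^-1) ->
  first_halves y \/ second_halves y.
Proof.
have [a [u [u01 ->]]] := wedge_cover y => yw ym.
have /eqP uN0 : u <> 0 by move=> u0; apply: yw; apply/wedge_end; [|left].
have /eqP uN1 : u <> 1 by move=> u0; apply: yw; apply/wedge_end; [|right].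
have /eqP uN2 : u <> 2^-1 by move=> u0; apply: (ym a); rewrite u0.
case: (ltgtP u 2^-1) uN2 => // u2 _; [left|right]; exists a => //; exists u => //=;
  by rewrite in_itv /=; lra.
Qed.

Lemma open_first_halves : open first_halves.
Proof.
suff -> : first_halves = ~` \bigcup_(a in [set: A]) (q a @` `[2^-1, 1]).
  by apply: closed_openC; apply: bigcup_arc_closed; lra.
apply/seteqP; split => [_ [a _ [u /= + <-]] [b _ [v /=]]|y ny].
  by rewrite !in_itv /= => u01 v01 quv; have [|| _] := wedge_inj _ _ (esym quv); lra.
have [a [u [u01 yE]]] := wedge_cover y; exists a => //; exists u => //=.
rewrite in_itv /=; apply/andP; split.
  rewrite lt_neqAle; apply/andP; split; last by lra.
  (* At [u = 0] the point is the wedge point, which also equals [q a 1] in a closed second half. *)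
  apply/eqP => u0; apply: ny; exists a => //; exists 1; first by rewrite /= in_itv /=; lra.
  by transitivity w; [apply/wedge_end; [lra|right]|rewrite yE; apply/esym/wedge_end; [|left]].
rewrite ltNge; apply/negP => u2; apply: ny; exists a => //; exists u => //=.
by rewrite in_itv /=; lra.
Qed.

Lemma open_second_halves : open second_halves.
Proof.
suff -> : second_halves = ~` \bigcup_(a in [set: A]) (q a @` `[0, 2^-1]).
  by apply: closed_openC; apply: bigcup_arc_closed; lra.
apply/seteqP; split => [_ [a _ [u /= + <-]] [b _ [v /=]]|y ny].
  by rewrite !in_itv /= => u01 v01 quv; have [|| _] := wedge_inj _ _ (esym quv); lra.
have [a [u [u01 yE]]] := wedge_cover y; exists a => //; exists u => //=.
rewrite in_itv /=; apply/andP; split.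
  rewrite ltNge; apply/negP => u2; apply: ny; exists a => //; exists u => //=.
  by rewrite in_itv /=; lra.
rewrite lt_neqAle; apply/andP; split; last by lra.
apply/eqP => u0; apply: ny; exists a => //; exists 0; first by rewrite /= in_itv /=; lra.
by transitivity w; [apply/wedge_end; [lra|left]|rewrite yE; apply/esym/wedge_end; [|right]].
Qed.

(** [positive_path] makes the parameter [h] increasing but does not say that it is continuous. If it
    jumped past [c] at [t0], the path just after [t0] would lie in the closed arc from [c] to [M],
    which misses [gamma t0]. *)
Lemma right_step (gamma : R -> Y) (t0 : R) : continuous gamma -> positive_path q gamma ->
  exists a u, [/\ 0 <= u < 1, gamma t0 = q a u & forall c del, u < c -> 0 < del ->
    exists t v, [/\ t0 < t < t0 + del, u < v < c & gamma t = q a v]].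
Proof.
move=> gc /(_ t0)[e [_ [a [_ [h [e0 _ hinc _ hq]]]]]].
have hm s t : t0 <= s -> s < t -> t <= t0 + e -> h s < h t.
  by move=> *; apply: hinc; rewrite //= in_itv /=; lra.
have hr t : t0 <= t -> t <= t0 + e -> 0 <= h t <= 1.
  by move=> *; have [] := hq t; rewrite in_itv //=; lra.
have gq t : t0 <= t -> t <= t0 + e -> gamma t = q a (h t).
  by move=> *; have [] := hq t; rewrite in_itv //=; lra.
have ht0 := hr t0 (lexx _) _; have hte := hr (t0 + e) _ (lexx _).
have hlt := hm t0 (t0 + e) (lexx _) _ (lexx _).
exists a, (h t0); split; [lra|by apply: gq; lra|].
move=> c del uc del0; apply: contrapT => none.
(* Taking [d < e] gives [M < 1], so the closed arc avoids the wedge point, where [gamma t0] may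
   be. *)
pose d := Num.min e del / 2.
have [d0 de ddel] : [/\ 0 < d, d < e & d < del].
  by rewrite /d; split; case: (leP e del) => ?; lra.
pose M := h (t0 + d).
have M1 : M < 1.
  by have := hm (t0 + d) (t0 + e); rewrite -/M; lra.
have inC t : t0 < t -> t <= t0 + d -> (q a @` `[c, M]) (gamma t).
  move=> tt0 td; exists (h t); last by apply/esym/gq; lra.
  rewrite /= in_itv /=; apply/andP; split.
    rewrite leNgt; apply/negP => htc; apply: none; exists t, (h t).
    by split; [lra|rewrite htc andbT; apply: hm; lra|apply: gq; lra].
  have [td'|td'|->//] := ltgtP t (t0 + d); last by lra.
  by apply/ltW/hm; lra.
have : ~ (q a @` `[c, M]) (gamma t0).
  rewrite gq; [|lra|lra] => -[v /=]; rewrite in_itv /= => vcM qv.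
  by have [|| _ vh] := wedge_inj _ _ qv; lra.
have oC : open (gamma @^-1` (~` (q a @` `[c, M]))).
  apply: open_comp => [x _|]; first exact: gc.
  by apply: closed_openC; apply: arc_closed; lra.
move=> nC; have /nbhs_ballP[r /= r0 rball] := open_nbhs_nbhs (conj oC nC).
have [rd|dr] := leP r d.
  apply: (rball (t0 + r / 2)); last by apply: inC; lra.
  by rewrite /ball /= opprD addrA subrr add0r normrN ger0_norm; lra.
apply: (rball (t0 + d)); last by apply: inC; lra.
by rewrite /ball /= opprD addrA subrr add0r normrN ger0_norm; lra.
Qed.

(** Off the wedge point, the open circle [b] and the complement of the closed circle are disjoint
    open sets covering everything, so a path cannot pass between them. *)
Lemma exit_through_wedge_point (gamma : R -> Y) b (s t : R) : continuous gamma ->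
  (q b @` `]0, 1[) (gamma s) -> ~ (q b @` `]0, 1[) (gamma t) ->
  exists r, Num.min s t <= r <= Num.max s t /\ gamma r = w.
Proof.
move=> gc gs gt; apply: contrapT => none; apply: gt.
apply: (open_disjoint_stay gc (O2 := ~` (q b @` `[0, 1])) (i := `[Num.min s t, Num.max s t])
  (open_arc b) _ _ _ _ gs).
- by apply: closed_openC; exact: arc_closed.
- rewrite -subset0 => _ [[u /= u01 <-]]; apply; exists u => //=.
  by move: u01; rewrite !in_itv /=; lra.
- move=> r; rewrite in_itv /= => rst.
  have [[u /= + gu]|] := pselect ((q b @` `[0, 1]) (gamma r)); last by right.
  rewrite in_itv /= => u01; left; exists u => //=.
  have uw : ~ (u = 0 \/ u = 1).
    by move=> /(wedge_end b u01) qw; apply: none; exists r; rewrite -gu.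
  have /eqP u0 : u <> 0 by move=> ?; apply: uw; left.
  have /eqP u1 : u <> 1 by move=> ?; apply: uw; right.
  by rewrite in_itv /=; lra.
- by rewrite in_itv /= ge_min le_max !lexx.
- by rewrite in_itv /= ge_min le_max !lexx !orbT.
Qed.

Lemma wedge_closed_arc_max b (C : set Y) (u c : R) : closed C ->
  0 <= u <= c -> c <= 1 -> C (q b u) ->
  exists2 m, u <= m <= c & C (q b m) /\ forall v, m < v <= c -> ~ C (q b v).
Proof.
move=> cC uc c1 Cu.
have [|||m [/= + Cm] mub] := @closed_has_max _ (`[u, c] `&` q b @^-1` C).
- by apply: arc_preimage_closed => //; lra.
- by exists u; split => //=; rewrite in_itv /=; lra.
- by exists c => v [/=]; rewrite in_itv /=; lra.
rewrite in_itv /= => ucm; exists m => //; split => // v vm Cv.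
suff : v <= m by lra.
by apply: mub; split => //=; rewrite in_itv /=; lra.
Qed.

(* Otherwise the positive path through the last point below c that lies in C goes further. *)
Lemma closed_positive_forward b (C : set Y) (u c : R) : closed C ->
  (forall y, C y -> exists gamma : R -> Y, [/\ continuous gamma, positive_path q gamma,
     gamma 0 = y & forall t, C (gamma t)]) ->
  0 < u <= c -> c <= 1 -> C (q b u) -> C (q b c).
Proof.
move=> cC Cpath uc c1 Cu.
have [|m ucm [Cm mmax]] := wedge_closed_arc_max cC _ c1 Cu; first by lra.
have [mc|cm|<-//] := ltgtP m c; last by lra.
have [gamma [gc gp g0 gC]] := Cpath _ Cm.
have [a [v [v01 gv step]]] := right_step 0 gc gp.
have [|||? ?] := @wedge_inj b a m v _ _ _; [lra|lra|by rewrite -g0|]; subst a v.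
have [t [v [_ vc gtv]]] := step c 1 mc ltr01.
by case: (mmax v); [lra|rewrite -gtv].
Qed.

(** Reversing every circle along with time turns statements about the future of a positive path into
    statements about its past. *)
Lemma oriented_wedge_rev : oriented_wedge w (fun a t => q a (1 - t)).
Proof.
move: (wedge) => [hY cq q0 qs qq].
have rev (t : R) : (t \in `[0, 1]) = (1 - t \in `[0, 1] :> bool).
  by rewrite !in_itv /=; apply/idP/idP => ?; lra.
have revE (t : R) : ((1 - t == 0) || (1 - t == 1)) = ((t == 0) || (t == 1)).
  by apply/idP/idP => /orP[]/eqP tE; apply/orP; [right|left|right|left]; apply/eqP; lra.
split => //.
- move=> a; apply/continuous_closedP => C cC; apply/closed_subspaceP.
  exists ((fun t => 1 - t) @^-1` (`[0, 1] `&` q a @^-1` C)).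
    apply: closed_comp => [t _|]; last exact: arc_preimage_closed.
    by apply: cvgB; [exact: cvg_cst|exact: cvg_id].
  apply/seteqP; split => t [/=]; first by move=> [_ Ct].
  by move=> Ct t01; split => //; split => //; rewrite -rev.
- by move=> a; rewrite subr0; apply/wedge_end; [lra|right].
- move=> y; have [a [t [t01 <-]]] := qs y; exists a, (1 - t).
  by split; [rewrite -rev|congr q; lra].
- move=> a a' t t' t01 t01'; rewrite qq -?rev// !revE.
  split=> [[[-> tt]|]|[[-> ->]|]]; [left; split => //; lra|by right|by left|by right].
Qed.

End Wedge.

(** * Time reversal and returns to the wedge point *)

Section WedgeBackward.
Variables (R : realType) (A : finType) (Y : topologicalType) (w : Y) (q : A -> R -> Y).
Hypothesis wedge : oriented_wedge w q.
Let qr a t := q a (1 - t).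

Lemma positive_path_rev (gamma : R -> Y) :
  positive_path q gamma -> positive_path qr (fun t => gamma (- t)).
Proof.
move=> gp t0; have [e [a [a' [h [h' [e0 hinc hinc' hq hq']]]]]] := gp (- t0).
exists e, a', a, (fun t => 1 - h' (- t)), (fun t => 1 - h (- t)); split => //.
- move=> u v /=; rewrite !in_itv /= => ut vt uv.
  suff : h' (- v) < h' (- u) by lra.
  by apply: hinc'; rewrite /= ?in_itv /=; lra.
- move=> u v /=; rewrite !in_itv /= => ut vt uv.
  suff : h (- v) < h (- u) by lra.
  by apply: hinc; rewrite /= ?in_itv /=; lra.
- move=> t; rewrite in_itv /= => tt.
  have [|+ ->] := hq' (- t); first by rewrite in_itv /=; lra.
  by rewrite !in_itv /= => ?; split; [lra|rewrite /qr; congr q; lra].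
- move=> t; rewrite in_itv /= => tt.
  have [|+ ->] := hq (- t); first by rewrite in_itv /=; lra.
  by rewrite !in_itv /= => ?; split; [lra|rewrite /qr; congr q; lra].
Qed.

Lemma continuous_rev (gamma : R -> Y) : continuous gamma -> continuous (fun t => gamma (- t)).
Proof. by move=> gc t; apply: continuous_comp; [exact: opp_continuous|exact: gc]. Qed.

Lemma left_step (gamma : R -> Y) (t0 : R) : continuous gamma -> positive_path q gamma ->
  exists a u, [/\ 0 < u <= 1, gamma t0 = q a u & forall c del, c < u -> 0 < del ->
    exists t v, [/\ t0 - del < t < t0, c < v < u & gamma t = q a v]].
Proof.
move=> gc gp.
have [a [u [u01 gu step]]] :=
  right_step (oriented_wedge_rev wedge) (- t0) (continuous_rev gc) (positive_path_rev gp).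
rewrite opprK in gu; exists a, (1 - u); split => //; first by lra.
move=> c del cu del0; have [|t [v [tt vv gt]]] := step (1 - c) del _ del0; first by lra.
by exists (- t), (1 - v); split => //; lra.
Qed.

(** [C] models the projection of a closed invariant set. A path in [C] reaches an interior point of
    some circle [b]; moving forward fills the circle after that point, and the reversed wedge fills
    it before. *)
Lemma closed_positive_circle (C : set Y) : closed C -> C !=set0 ->
  (forall y, C y -> exists gamma : R -> Y, [/\ continuous gamma, positive_path q gamma,
     gamma 0 = y & forall t, C (gamma t)]) ->
  exists b, forall u, 0 <= u <= 1 -> C (q b u).
Proof.
move=> cC [y Cy] Cpath.
have [gamma [gc gp _ gC]] := Cpath y Cy.
have [b [u [u01 _ step]]] := right_step wedge 0 gc gp.
have [|t [v [_ vu gt]]] := step 1 1 _ ltr01; first by lra.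
have Cv : C (q b v) by rewrite -gt.
exists b.
have C1 : C (q b 1) by apply: (closed_positive_forward wedge cC Cpath _ _ Cv); lra.
have C0 : C (q b 0).
  move: (wedge) => [_ _ q0 _ _]; rewrite q0 -(_ : q b 1 = w)//.
  by apply/(wedge_end wedge); [lra|right].
move=> c c01.
have [vc|cv] := leP v c.
  by apply: (closed_positive_forward wedge cC Cpath _ _ Cv); lra.
have -> : q b c = qr b (1 - c) by rewrite /qr; congr q; lra.
have Cv' : C (qr b (1 - v)) by rewrite /qr (_ : 1 - (1 - v) = v)//; lra.
apply: (closed_positive_forward (oriented_wedge_rev wedge) cC _ _ _ Cv'); [|lra|lra].
move=> z Cz; have [g [gc' gp' g0 gC']] := Cpath z Cz.
exists (fun t => g (- t)); split => //; rewrite ?oppr0//.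
- exact: continuous_rev.
- exact: positive_path_rev.
Qed.

(** The path leaves the wedge point through a first half. Without a midpoint it stays in first
    halves until its next visit to the wedge point, yet it must arrive there from a second half. *)
Lemma return_meets_midpoint (gamma : R -> Y) (t1 t2 : R) :
  continuous gamma -> positive_path q gamma ->
  t1 < t2 -> gamma t1 = w -> gamma t2 = w ->
  exists t a, t1 < t < t2 /\ gamma t = q a 2^-1.
Proof.
move=> gc gp t12 g1 g2; apply: contrapT => nomid.
have [a [u [u01 gu step]]] := right_step wedge t1 gc gp.
have u0 : u = 0.
  by have [|//|] := (wedge_end wedge a _).1 (etrans (esym gu) g1); lra.
subst u; have [||t0 [v [t0b v2 gt0]]] := step 2^-1 (t2 - t1); [lra|lra|].
have nw : gamma t0 <> w.
  rewrite gt0 => /(wedge_end wedge a _).1 []; lra.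
have [|s1 [s2 [s1b s2b Bs1 Bs2 Bs]]] :=
  excursion gc (wedge_point_closed wedge) _ g1 g2 nw; first by lra.
have half : forall t, t \in `]s1, s2[ -> first_halves q (gamma t).
  apply: (open_disjoint_stay gc (open_first_halves wedge) (open_second_halves wedge)
    (halves_disjoint wedge) (t0 := t0)).
  - move=> t; rewrite in_itv /= => ts.
    apply: (halves_cover wedge) => [|b gb]; first exact: Bs.
    by apply: nomid; exists t, b; split => //; lra.
  - by rewrite in_itv /=; lra.
  - by rewrite gt0; exists a => //; exists v => //=; rewrite in_itv /=; lra.
have [a' [u' [u01' gu' step']]] := left_step s2 gc gp.
have u1 : u' = 1.
  by have [||//] := (wedge_end wedge a' _).1 (etrans (esym gu') Bs2); lra.
subst u'; have [||t [v' [tb v2' gt]]] := step' 2^-1 (s2 - s1); [lra|lra|].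
have [|b _ [v'' /=]] := half t; first by rewrite in_itv /=; lra.
rewrite in_itv /= gt => vb qv.
by have [|| _] := wedge_inj wedge _ _ qv; lra.
Qed.

End WedgeBackward.

(** * Paths that traverse a word *)

Section Words.
Variables (R : realType) (A : eqType) (Y : topologicalType) (q : A -> R -> Y).
Variables (gamma : R -> Y) (u : seq A).
Hypothesis gamma_u : traverses_word q gamma u.

Lemma traverses_word_sub (t : R) : 0 <= t <= 1 ->
  exists a v, [/\ a \in u, 0 <= v <= 1 & gamma t = q a v].
Proof.
move: gamma_u => [ts [szs ts0 ts1 step]] t01.
(* The subdivision is searched downwards until a point below [t] or the initial point is met. *)
have loc n : (n <= size u)%N -> (0 < n)%N -> t <= nth 0 ts n ->
    exists2 j, (j < size u)%N & nth 0 ts j <= t <= nth 0 ts j.+1.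
  elim: n => // n IH nu _ tn; case: (leP t (nth 0 ts n)) => [tn'|ntn]; last first.
    by exists n => //; rewrite tn ltW.
  case: n IH nu tn tn' => [|n] IH nu tn tn'; last by apply: IH => //; exact: ltnW.
  by exists 0%N => //; rewrite tn andbT ts0; lra.
have [||j ju tj] := loc (size u) (leqnn _); last 1 first.
- case uj: (onth u j) => [a|]; last by move: (onthTE u j); rewrite uj ju.
  have [jlt [h [_ h0 h1 hinc hq]]] := step j a uj.
  exists a, (h t); split.
  + by apply/onthP; exists j.
  + have tin : `[nth 0 ts j, nth 0 ts j.+1]%classic t by rewrite /= in_itv.
    have lin : `[nth 0 ts j, nth 0 ts j.+1]%classic (nth 0 ts j).
      by rewrite /= in_itv /= lexx ltW.
    have rin : `[nth 0 ts j, nth 0 ts j.+1]%classic (nth 0 ts j.+1).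
      by rewrite /= in_itv /= lexx ltW.
    move: tj => /andP[]; rewrite le_eqVlt => /orP[/eqP<- _|lt1].
      by rewrite h0 lexx ler01.
    rewrite le_eqVlt => /orP[/eqP->|lt2]; first by rewrite h1 lexx ler01.
    by apply/andP; split; [rewrite -h0|rewrite -h1]; apply/ltW/hinc.
  + by apply: hq; rewrite in_itv.
(* The word is nonempty, since the subdivision runs from 0 to 1. *)
- rewrite lt0n; apply/eqP => u0; move: ts1.
  by rewrite u0 ts0 => /eqP; rewrite eq_sym oner_eq0.
- by rewrite ts1; lra.
Qed.

(** The intermediate value theorem applies to the parameter on the piece of an occurrence of [a]. *)
Lemma traverses_word_sup (a : A) (v : R) : a \in u -> 0 <= v <= 1 ->
  exists t, 0 <= t <= 1 /\ gamma t = q a v.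
Proof.
move: gamma_u => [ts [szs ts0 ts1 step]] /onthP[j uj] v01.
have mono i k : (i + k <= size u)%N -> nth 0 ts i <= nth 0 ts (i + k).
  elim: k => [|k IH] ik; first by rewrite addn0.
  apply: (le_trans (IH _)); first by move: ik; rewrite addnS; exact: ltnW.
  rewrite addnS in ik *.
  case ub: (onth u (i + k)) => [b|]; last by move: (onthTE u (i + k)); rewrite ub ik.
  by have [/ltW] := step _ _ ub.
have ju : (j < size u)%N by rewrite -onthTE uj.
have [jlt [h [hc h0 h1 hinc hq]]] := step j a uj.
have [|t tj ht] := @IVT _ h _ _ v (ltW jlt) hc.
  by rewrite h0 h1 (min_idPl ler01) (max_idPr ler01).
exists t; split; last by rewrite hq // ht.
move: tj; rewrite in_itv /=.
have := mono 0%N j; rewrite add0n ts0 => /(_ (ltnW ju)).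
have := mono j.+1 (size u - j.+1)%N; rewrite subnKC // ts1 => /(_ (leqnn _)).
lra.
Qed.

End Words.

(** * Recurrence and return times of a flow *)

Section Flow.
Variables (R : realType) (X : topologicalType) (phi : R -> X -> X).
Hypothesis flow : is_flow phi.

Lemma flow0 x : phi 0 x = x. Proof. by case: flow. Qed.

Lemma flowD s t x : phi (s + t) x = phi s (phi t x). Proof. by case: flow. Qed.

Lemma flow_near t x (V : set X) : nbhs (phi t x) V ->
  exists J W, [/\ nbhs t J, nbhs x W & forall t' x', J t' -> W x' -> V (phi t' x')].
Proof.
move=> Vn; case: flow => cphi _ _.
have [[J W] /= [Jn Wn] JW] := cphi (t, x) V Vn.
by exists J, W; split => // t' x' Jt Wx; exact: (JW (t', x')).
Qed.

Lemma flow_orbit_continuous x : continuous (fun t => phi t x).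
Proof.
move=> t V /flow_near[J [W [Jn Wn JW]]]; apply: filterS Jn => t' Jt'.
by apply: JW => //; exact: nbhs_singleton.
Qed.

Lemma flow_time_continuous t : continuous (phi t).
Proof.
move=> x V /flow_near[J [W [Jn Wn JW]]]; apply: filterS Wn => x' Wx'.
by apply: JW => //; exact: nbhs_singleton.
Qed.

(** Density of orbits moves each point into [U] at some time; the same time serves nearby points,
    and compactness bounds these times. *)
Lemma minimal_syndetic (U : set X) : compact [set: X] -> minimal_flow phi ->
  open U -> U !=set0 ->
  exists2 T, 0 < T & forall y, exists t, -T <= t <= T /\ U (phi t y).
Proof.
move=> /compact_near_coveringP cX min oU U0.
pose P T y := exists t, -T <= t <= T /\ U (phi t y).
have [y _|M [_ HM]] := cX R (pinfty_nbhs R) P _.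
  have [z [Ut [t _ tz]]] := min y U U0 oU; rewrite -{}tz in Ut.
  exists (phi t @^-1` U, [set T | `|t| < T]) => /=.
    split; last by exists `|t|; split.
    by apply: open_nbhs_nbhs; split => //; apply: open_comp => // ? _; exact: flow_time_continuous.
  move=> [z' T] /= [Uz tT]; exists t; split => //.
  by rewrite -ler_norml ltW.
exists (Num.max M 0 + 1); first by rewrite ltr_wpDl // le_max lexx orbT.
move=> y; apply: HM => //.
by rewrite (@le_lt_trans _ _ (Num.max M 0)) ?le_max ?lexx// ltrDl.
Qed.

Lemma periodic_orbit (r : R) x t : 0 < r -> phi r x = x ->
  exists t', 0 <= t' < r /\ phi t x = phi t' x.
Proof.
move=> r0 per.
have pern n : phi (r *+ n) x = x.
  by elim: n => [|n IH]; [rewrite mulr0n flow0|rewrite mulrS flowD IH].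
have perz (k : int) : phi (r *~ k) x = x.
  case: k => n; first exact: pern.
  by rewrite NegzE mulrNz -{1}(pern n.+1) -flowD addNr flow0.
(* Removing the whole periods leaves a remainder between 0 and [r]. *)
exists (t - r *~ Num.floor (t / r)); split.
  have /andP[] := floor_itv (t / r).
  rewrite ler_pdivlMr // ltr_pdivrMr // intrD mulrDl -mulrzl.
  lra.
by rewrite -[in LHS](subrK (r *~ Num.floor (t / r)) t) [LHS]flowD perz.
Qed.

(* As m grows, P m shrinks to x0, so a limit of return times to P m is either
excluded or a period of x0; in the latter case one period already meets U. *)
Lemma shrinking_returns_meet (P : nat -> set X) (x0 : X) (U : set X) (eps T : R) :
  hausdorff_space X -> dense (Defs.orbit phi x0) -> open U -> U !=set0 -> 0 < eps ->
  (forall W, nbhs x0 W -> exists N, forall m, (N <= m)%N -> P m `<=` W) ->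
  exists N, forall m, (N <= m)%N -> forall r x, eps <= r <= T ->
    P m x -> P m (phi r x) -> exists t, 0 <= t <= r /\ U (phi t x).
Proof.
move=> hX dx0 oU U0 eps0 shrink.
have sep := hX; rewrite open_hausdorff in sep.
pose G m r := forall x, P m x -> P m (phi r x) -> exists t, 0 <= t <= r /\ U (phi t x).
(* Compactness of the range of return times yields one [N] from a local choice near each [r]. *)
have /compact_near_coveringP cov := @segment_compact R eps T.
have [r /=|N _ HN] := cov nat \oo G _.
  rewrite in_itv /= => rT.
  have [per|nper] := pselect (phi r x0 = x0).
    (* Here [r] is a period, so [x0] meets [U] at some [t' < r]; this persists for points near [x0]
       and for every return time above [t']. *)
    have [z [Ut [t _ tz]]] := dx0 U U0 oU; rewrite -{}tz in Ut.
    have [|t' [t'r ttE]] := periodic_orbit t _ per; first by lra.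
    rewrite ttE in Ut.
    have [|N HN] := shrink (phi t' @^-1` U).
      by apply: flow_time_continuous; exact: open_nbhs_nbhs.
    exists ([set r' | t' < r'], [set m | (N <= m)%N]) => /=.
      by split; [apply: lt_nbhsr; lra|exists N].
    by move=> [r' m] /= [t'r' Nm] x /(HN m Nm) Ux _; exists t'; split => //; lra.
  (* Otherwise [phi r x0] and [x0] have disjoint neighbourhoods: a point near [x0] is in [W'] at
     times close to [r], hence outside [P m], which lies in [W]. *)
  have [[W' W] /= [/set_mem W'n /set_mem Wn] [oW' oW WW0]] :=
    sep _ _ (introN eqP nper).
  have [J [W2 [Jn W2n JW]]] := flow_near (open_nbhs_nbhs (conj oW' W'n)).
  have [|N HN] := shrink (W `&` W2).
    by apply: filterI => //; exact: open_nbhs_nbhs.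
  exists (J, [set m | (N <= m)%N]) => /=; first by split => //; exists N.
  move=> [r' m] /= [Jr' Nm] x /(HN m Nm)[_ W2x] /(HN m Nm)[Wx _].
  have : (W' `&` W) (phi r' x) by split => //; exact: JW.
  by rewrite (eqP WW0).
exists N => m Nm r x rT; apply: (HN m Nm r); rewrite /= in_itv //.
Qed.

End Flow.

(** * Expansions and their composed words *)

Section Expansion.
Variables (R : realType) (X : topologicalType) (phi : R -> X -> X).
Variables (A : nat -> finType) (s : forall i, A i.+1 -> seq (A i)).
Variables (Xw : nat -> topologicalType) (w : forall i, Xw i).
Variables (q : forall i, A i -> R -> Xw i) (f : forall i, Xw i.+1 -> Xw i).
Variables (p : forall i, X -> Xw i) (x0 : X).
Hypothesis hausdorffX : hausdorff_space X.
Hypothesis compactX : compact [set: X].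
Hypothesis flow : is_flow phi.
Hypothesis wedge : forall i, oriented_wedge (w i) (@q i).
Hypothesis f_w : forall i, f (w i.+1) = w i.
Hypothesis f_word : forall i b, traverses_word (@q i) (fun t => f (q b t)) (@s i b).
Hypothesis p_continuous : forall i, continuous (@p i).
Hypothesis p_surjective : forall i y, exists x, @p i x = y.
Hypothesis p_f : forall i x, p i x = f (p i.+1 x).
Hypothesis p_positive : forall i x, positive_path (@q i) (fun t => p i (phi t x)).
Hypothesis p_x0 : forall i, p i x0 = w i.
Hypothesis p_basis : forall (U : set X) x, open U -> U x ->
  exists i (V : set (Xw i)), [/\ open V, V (p i x) & p i @^-1` V `<=` U].

Lemma orbit_projection_continuous i x : continuous (fun t => p i (phi t x)).
Proof.
by move=> t; apply: continuous_comp; [exact: flow_orbit_continuous|exact: p_continuous].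
Qed.

(** Induction on [k] follows the maps [f] level by level through the letters of their words. *)
Lemma scomp_sub n k (b : A (k + n).+1) x (u : R) : 0 <= u <= 1 -> p (k + n).+1 x = q b u ->
  exists a v, [/\ a \in scomp s n k b, 0 <= v <= 1 & p n x = q a v].
Proof.
elim: k b u => [|k IH] b u u01 pu /=.
  by have [a [v [au v01 fv]]] := traverses_word_sub (f_word b) u01; exists a, v; rewrite p_f pu.
have [c [v [cu v01 fv]]] := traverses_word_sub (f_word b) u01.
have [|a [v' [ac v'01 pa]]] := IH c v v01; first by rewrite p_f pu.
by exists a, v'; split => //; apply/flattenP; exists (scomp s n k c) => //; exact: map_f.
Qed.

(** The parameter [u] is independent of [x], so the point over it can be chosen afterwards inside a
    given set. *)
Lemma scomp_sup n k (b : A (k + n).+1) (a : A n) (v : R) : a \in scomp s n k b ->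
  0 <= v <= 1 ->
  exists u, 0 <= u <= 1 /\ forall x, p (k + n).+1 x = q b u -> p n x = q a v.
Proof.
elim: k b => [|k IH] b /=.
  move=> ab v01; have [u [u01 fu]] := traverses_word_sup (f_word b) ab v01.
  by exists u; split => // x px; rewrite p_f px.
move=> /flattenP[_ /mapP[c cb ->] ac] v01.
have [u' [u'01 Hu']] := IH c ac v01.
have [u [u01 fu]] := traverses_word_sup (f_word b) cb u'01.
by exists u; split => // x px; apply: Hu'; rewrite p_f px.
Qed.

(** * Primitivity implies minimality *)

Lemma primitive_minimal : primitive_seq s -> minimal_flow phi.
Proof.
move=> prim x O [y Oy] oO.
have [i [V [oV Vy VO]]] := p_basis oO Oy.
have [k prim_k] := prim i.
pose Z := closure (Defs.orbit phi x).
have Zphi t z : Z z -> Z (phi t z).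
  move=> Zz B /(flow_time_continuous flow) /Zz[_ [[t' _ <-] Bt']].
  by exists (phi (t + t') x); split; [exists (t + t')|rewrite (flowD flow)].
have pZ_closed : closed (p (k + i).+1 @` Z).
  apply: compact_closed; first by case: (wedge (k + i).+1).
  apply: continuous_compact; first exact: continuous_subspaceT.
  by apply: (subclosed_compact _ compactX) => //; exact: closed_closure.
have [||b pb] := closed_positive_circle (wedge (k + i).+1) pZ_closed.
- exists (p (k + i).+1 x); exists x => //; apply: subset_closure.
  by exists 0 => //; rewrite (flow0 flow).
- move=> _ [z Zz <-]; exists (fun t => p (k + i).+1 (phi t z)); split => //.
  + exact: orbit_projection_continuous.
  + by rewrite (flow0 flow).
  + by move=> t; exists (phi t z) => //; exact: Zphi.
(* The letter [a] of the circle through [p i y] occurs in the word of [b], so a point of [Z] over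
   [b] has the same projection as [y]. *)
have [a [v [v01 pyv]]] := wedge_cover (wedge i) (p i y).
have [u [u01 Hu]] := scomp_sup (prim_k b a) v01.
have [z Zz pz] := pb u u01.
have Oz : O z by apply: VO; rewrite /= (Hu z pz) -pyv.
by have [t [? ?]] := Zz O (open_nbhs_nbhs (conj oO Oz)); exists t.
Qed.

(** * Visits to the wedge points; minimality implies primitivity *)

Lemma wedge_points_nested i m x : (i <= m)%N -> p m x = w m -> p i x = w i.
Proof.
elim: m => [|m IH]; first by rewrite leqn0 => /eqP ->.
rewrite leq_eqVlt => /orP[/eqP-> //|im] pm.
by apply: IH => //; rewrite p_f pm f_w.
Qed.

(** A basic neighbourhood of [x0] comes from one level [N], and points over deeper wedge points
    project to the wedge point there. *)
Lemma wedge_points_shrink (W : set X) : nbhs x0 W ->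
  exists N, forall m, (N <= m)%N -> p m @^-1` [set w m] `<=` W.
Proof.
rewrite nbhsE => -[B [oB Bx0] BW].
have [N [V [_ Vx0 VB]]] := p_basis oB Bx0.
exists N => m Nm x pm; apply/BW/VB => /=.
by rewrite (wedge_points_nested Nm pm) -p_x0.
Qed.

(** A return crosses a midpoint, while points over the wedge point stay off the midpoints for a
    short time, uniformly by compactness. *)
Lemma return_time_lower_bound n : exists2 eps, 0 < eps &
  forall r x, 0 < r < eps -> p n x = w n -> p n (phi r x) <> w n.
Proof.
pose M := [set @q n a 2^-1 | a in [set: A n]].
have wM : ~ M (w n).
  by move=> [a _ /(wedge_end (wedge n) a _).1 []]; lra.
have cK : compact (p n @^-1` [set w n]).
  apply: (subclosed_compact _ compactX) => //; apply: closed_comp => [x _|].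
    exact: p_continuous.
  exact: (wedge_point_closed (wedge n)).
move: cK => /compact_near_coveringP/(_ R (nbhs (0 : R)) (fun t x => ~ M (p n (phi t x)))).
move=> /(_ _)[x /= px|e /= e0 He].
  have [|J [W [Jn Wn JW]]] := @flow_near _ _ _ flow 0 x (p n @^-1` (~` M)).
    rewrite (flow0 flow); apply: p_continuous; apply: open_nbhs_nbhs.
    by split; [exact/closed_openC/(midpoints_closed (wedge n))|rewrite /= px].
  by exists (W, J) => //= -[x' t'] /= [Wx' Jt']; exact: JW.
exists e => // r x re px pr.
have [||t [a [tr ta]]] := return_meets_midpoint (wedge n)
  (@orbit_projection_continuous n x) (@p_positive n x) (_ : 0 < r) _ pr.
- by lra.
- by rewrite (flow0 flow).
apply: (He t _ x px); last by exists a.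
by rewrite /ball /= sub0r normrN gtr0_norm; lra.
Qed.

(* The stay of an orbit in a circle of X_m is an orbit segment between visits
to the wedge point, so it projects onto every circle of X_n once m is large. *)
Lemma minimal_letter n (a : A n) : minimal_flow phi ->
  exists N, forall k, (N <= k)%N -> forall b : A (k + n).+1, a \in scomp s n k b.
Proof.
move=> min; pose U := p n @^-1` (q a @` `]0, 1[).
have oU : open U.
  by apply: open_comp => [x _|]; [exact: p_continuous|exact: (open_arc (wedge n))].
have U0 : U !=set0.
  have [x px] := p_surjective (q a 2^-1); exists x; exists 2^-1 => //=.
  by rewrite in_itv /=; lra.
have [T T0 synd] := minimal_syndetic flow compactX min oU U0.
have [eps eps0 ret] := return_time_lower_bound n.
(* The excursion below takes place between times [-2T] and [2T], so it lasts at most [4T]. *)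
have [N HN] := shrinking_returns_meet flow (4 * T) hausdorffX (min x0) oU U0 eps0
  wedge_points_shrink.
exists N => k Nk b; apply: contrapT => nab.
set m := (k + n).+1 in b nab *.
(* If [a] is missing from the word of [b], nothing over the closed circle [b] lies in [U]; reaching
   [U] forces an exit from [b]. *)
have missU z u : 0 <= u <= 1 -> p m z = q b u -> ~ U z.
  move=> u01 pz [v /=]; rewrite in_itv /= => v01 pv.
  have [a' [v' [a'b v'01 pv']]] := scomp_sub u01 pz.
  have [|||aa' _] := @wedge_inj _ _ _ _ _ (wedge n) a a' v v' => //.
    by rewrite pv pv'.
  by apply: nab; rewrite aa'.
have [y py] := p_surjective (q b 2^-1 : Xw m).
pose gamma t := p m (phi t y).
have gc : continuous gamma by exact: orbit_projection_continuous.
have g0 : (q b @` `]0, 1[) (gamma 0).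
  by exists 2^-1; rewrite /= ?in_itv /= /gamma ?(flow0 flow)//; lra.
have exit t : U (phi t y) -> exists r, Num.min 0 t <= r <= Num.max 0 t /\ gamma r = w m.
  move=> Ut; apply: (exit_through_wedge_point (wedge m) gc g0) => -[u /=].
  by rewrite in_itv /= => u01 /esym gu; apply: (missU _ u _ gu Ut); lra.
(* Searching from [phi (- T) y] places the visit to [U] in the past of [y]; searching from [phi T y]
   then places one in its future. *)
have [t1 [t1T w1]] : exists t1, - (2 * T) <= t1 <= 0 /\ gamma t1 = w m.
  have [t [tT]] := synd (phi (- T) y); rewrite -(flowD flow) => /exit[r [rt gr]].
  by exists r; split => //; move: rt; rewrite minEle maxEle; case: ifP => _; lra.
have [t2 [t2T w2]] : exists t2, 0 <= t2 <= 2 * T /\ gamma t2 = w m.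
  have [t [tT]] := synd (phi T y); rewrite -(flowD flow) => /exit[r [rt gr]].
  by exists r; split => //; move: rt; rewrite minEle maxEle; case: ifP => _; lra.
have ng0 : gamma 0 <> w m.
  rewrite /gamma (flow0 flow) py => /(wedge_end (wedge m) b _).1 []; lra.
have [|s1 [s2 [s1b s2b ws1 ws2 nws]]] :=
  excursion gc (wedge_point_closed (wedge m)) _ w1 w2 ng0; first by lra.
have stay t : s1 < t < s2 -> (q b @` `]0, 1[) (gamma t).
  move=> ts; apply: contrapT => /(exit_through_wedge_point (wedge m) gc g0)[r [rt gr]].
  apply: (nws r) => //.
  by move: rt; rewrite minEle maxEle; case: ifP => _; lra.
have ps2 : p m (phi (s2 - s1) (phi s1 y)) = w m by rewrite -(flowD flow) subrK.
have eps_le : eps <= s2 - s1.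
  rewrite leNgt; apply/negP => lt_eps.
  have nm : (n <= m)%N by rewrite /m; lia.
  apply: (ret (s2 - s1) (phi s1 y)); first by lra.
  - exact: wedge_points_nested nm ws1.
  - exact: wedge_points_nested nm ps2.
have [||t [tr]] := HN m _ (s2 - s1) (phi s1 y) _ ws1 ps2.
- by rewrite /m; lia.
- by lra.
rewrite -(flowD flow).
(* The visit to [U] falls between [s1] and [s2]: inside, the orbit is over [b], and at both ends it
   is over [q b 0], so [missU] excludes every case. *)
have q0 : q b 0 = w m by case: (wedge m).
have [ts1|ts1|ts1] := ltgtP s1 (t + s1); last 1 first.
- by rewrite -ts1; apply: (missU _ 0); [lra|rewrite q0].
- have [ts2|ts2|ts2] := ltgtP (t + s1) s2; last 1 first.
  + by rewrite ts2; apply: (missU _ 0); [lra|rewrite q0].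
  + have [|u /=] := stay (t + s1); first by lra.
    by rewrite in_itv /= => u01 /esym gu; apply: missU gu; lra.
  + lra.
- lra.
Qed.

Lemma minimal_primitive : minimal_flow phi -> primitive_seq s.
Proof.
move=> min n; have [N HN] := choice (fun a : A n => minimal_letter a min).
(* Each threshold remains valid at higher levels, so the maximum over the finite alphabet serves all
   letters. *)
exists (\max_a N a)%N => b a; apply: HN; exact: leq_bigmax.
Qed.

End Expansion.

(** * The equivalence for represented flow spaces *)

Theorem theorem3p9 (R : realType) (X : pseudoMetricType R) (phi : R -> X -> X)
  (A : nat -> finType) (s : forall i, A i.+1 -> seq (A i)) :
  flow_space phi -> aperiodic_flow phi -> represents s phi -> proper_seq s ->
  (minimal_flow phi <-> primitive_seq s).
Proof.
move=> [hX cX _ flow _] _ [Xw [w [q [f [p [x0 [wedge Hf Hp _ [_ basis]]]]]]]] _.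
split.
- apply: (minimal_primitive (w := w) (q := q) (f := f) (p := p) (x0 := x0)) => //.
  + by move=> i; case: (Hf i).
  + by move=> i; case: (Hf i).
  + by move=> i; case: (Hp i).
  + by move=> i; case: (Hp i).
  + by move=> i; case: (Hp i).
  + by move=> i; case: (Hp i).
  + by move=> i; case: (Hp i).
- apply: (primitive_minimal (w := w) (q := q) (f := f) (p := p)) => //.
  + by move=> i; case: (Hf i).
  + by move=> i; case: (Hp i).
  + by move=> i; case: (Hp i).
  + by move=> i; case: (Hp i).
Qed.
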